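(* Let $V=(J,(V_j)_{j\in J},d,H)$ be a hypergraph system. For each $e\in H$ let $f_e:V_e\to[0,1]$ be such that $$\mathbb{E}\Big(\prod_{e\in H}f_e(\pi_e(x))\ \Big|\ x\in V_J\Big)\le\delta$$ for some $0<\delta<1$. Then for each $e\in H$ there exists a set $E'_e\in\mathcal{A}_e$ such that $\bigcap_{e\in H}E'_e=\emptyset$ and $$\mathbb{E}\big(f_e(\pi_e(x))\,1_{V_J\setminus E'_e}(x)\mid x\in V_J\big)=o_{\delta\to0}(1)\quad\text{for all }e\in H.$$ Furthermore, there exist $\sigma$-algebras $\mathcal{B}_{e'}\subseteq\mathcal{A}_{e'}$ for all $e'\subseteq J$ with $|e'|<d$, such that $|\mathcal{B}_{e'}|=O_\delta(1)$ for all such $e'$ and $E'_e\in\bigvee_{e'\subsetneq e}\mathcal{B}_{e'}$ for all $e\in H$.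
   Context: A hypergraph system is a quadruple $V=(J,(V_j)_{j\in J},d,H)$ where $J$ is a finite set, each $V_j$ is a finite nonempty set, $d\ge1$ is an integer and $H\subseteq\binom{J}{d}:=\{e\subseteq J:|e|=d\}$. For $e\subseteq J$ put $V_e:=\prod_{j\in e}V_j$, let $\pi_e:V_J\to V_e$ be the coordinate projection and $\mathcal{A}_e:=\{\pi_e^{-1}(E):E\subseteq V_e\}$. $\bigvee$ denotes the smallest $\sigma$-algebra containing the given ones; $|\mathcal{B}|$ is the number of sets in the finite $\sigma$-algebra $\mathcal{B}$. $\mathbb{E}(f(x)\mid x\in Z):=|Z|^{-1}\sum_{x\in Z}f(x)$. Implicit constants may depend on $J$ (hence on $d,H$) but on nothing else, in particular not on the sets $V_j$ or the functions $f_e$: $o_{\delta\to0}(1)$ denotes a quantity bounded by $c(\delta)$ with $c(\delta)\to0$ as $\delta\to0$ ($c$ depending only on $J$), and $O_\delta(1)$ a quantity bounded by $C(\delta)$ ($C$ depending only on $J$ and $\delta$). *)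

(* Defs.v *)
From HB Require Import structures.
From mathcomp Require Import all_boot all_order all_algebra.
From mathcomp Require Import reals.
Set Implicit Arguments. Unset Strict Implicit. Unset Printing Implicit Defensive.
Import Order.TTheory GRing.Theory Num.Theory.
Local Open Scope ring_scope.

(* Index set J = 'I_n ; V_j = 'I_(m j) (finite, nonempty when 0 < m j). *)

Definition VJ (n : nat) (m : 'I_n -> nat) : finType :=
  {dffun forall j : 'I_n, 'I_(m j)}.

Definition Ve (n : nat) (m : 'I_n -> nat) (e : {set 'I_n}) : finType :=
  {dffun forall j : {j : 'I_n | j \in e}, 'I_(m (val j))}.

Definition proj (n : nat) (m : 'I_n -> nat) (e : {set 'I_n}) (x : VJ m) : Ve m e :=
  finfun (fun j : {j : 'I_n | j \in e} => x (val j)).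

Definition cylAlg (n : nat) (m : 'I_n -> nat) (e : {set 'I_n}) : {set {set VJ m}} :=
  [set (proj e @^-1: E) | E : {set Ve m e}].

Definition is_sigma (T : finType) (B : {set {set T}}) : bool :=
  [&& set0 \in B,
      [forall A in B, ~: A \in B] &
      [forall A in B, forall A' in B, A :|: A' \in B]].

Definition sigma_join (T : finType) (F : {set {set T}}) : {set {set T}} :=
  \bigcap_(S : {set {set T}} | is_sigma S && (F \subset S)) S.

Definition expect (R : realType) (T : finType) (Z : {set T}) (g : T -> R) : R :=
  (#|Z|%:R)^-1 * \sum_(x in Z) g x.

(* Main.v *)
Require Import Defs.
From HB Require Import structures.
From mathcomp Require Import all_boot all_order all_algebra.
From mathcomp Require Import reals.
From mathcomp Require boolp.
From mathcomp Require Import ring lra.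
Import Order.TTheory GRing.Theory Num.Theory.
Local Open Scope ring_scope.
Set Implicit Arguments. Unset Strict Implicit. Unset Printing Implicit Defensive.

(** Replace each [f e] by the set [E e] where it is at least [eps / 2], and
    regularize downwards: given generators [P e] for [#|e| = j + 1], an energy
    increment gives coarse generators one level below, and a fine refinement of
    them, such that the cells of [P e] are as uniform relative to the fine ones
    as any prescribed function of the coarse complexity, while their fine and
    coarse conditional expectations are close in [L^2].  The counting lemma,
    proved by induction on the level, estimates the density of an intersection
    of cells together with an arbitrary set [U] that depends only on the
    coordinates in some [e0].  This freedom in [U] is what makes the induction
    close: the set where fine and coarse expectations differ is itself such a
    [U], so the lower level bounds its share of the cell and no hypergraph with
    doubled vertices is needed.  Finally [E' e] consists of the points whose
    lower-order cells meet [E e] in a good point; a common point of all the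
    [E' e] would force the [E e] to intersect in more than the hypothesis
    allows. *)

(** * Means and conditional expectations on a finite space *)

Section Mean.
Variables (R : realType) (X : finType).
Implicit Types (f g : X -> R) (S T : {set X}) (Q : {set {set X}}).

Definition mean f : R := (\sum_x f x) / #|X|%:R.

Definition ind S x : R := (x \in S)%:R.

Lemma eq_mean f g : (forall x, f x = g x) -> mean f = mean g.
Proof. by move=> fg; rewrite /mean; congr (_ / _); apply: eq_bigr => x _. Qed.

Lemma meanD f g : mean (fun x => f x + g x) = mean f + mean g.
Proof. by rewrite /mean big_split mulrDl. Qed.

Lemma meanB f g : mean (fun x => f x - g x) = mean f - mean g.
Proof. by rewrite /mean sumrB mulrBl. Qed.

Lemma meanZ a f : mean (fun x => a * f x) = a * mean f.
Proof. by rewrite /mean -mulr_sumr mulrA. Qed.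

Lemma le_mean f g : (forall x, f x <= g x) -> mean f <= mean g.
Proof.
by move=> fg; rewrite ler_wpM2r ?invr_ge0 ?ler0n//; apply: ler_sum => x _.
Qed.

Lemma mean_ge0 f : (forall x, 0 <= f x) -> 0 <= mean f.
Proof. by move=> f0; rewrite divr_ge0 ?ler0n ?sumr_ge0. Qed.

Lemma ler_norm_mean f : `|mean f| <= mean (fun x => `|f x|).
Proof.
rewrite normrM normfV normr_nat ler_wpM2r ?invr_ge0 ?ler0n//.
exact: ler_norm_sum.
Qed.

Lemma mean_sum (I : finType) (P : pred I) (F : I -> X -> R) :
  mean (fun x => \sum_(i | P i) F i x) = \sum_(i | P i) mean (F i).
Proof. by rewrite /mean exchange_big mulr_suml. Qed.

Lemma ind_ge0 S x : 0 <= ind S x.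
Proof. exact: ler0n. Qed.

Lemma ind_le1 S x : ind S x <= 1.
Proof. by rewrite /ind; case: (x \in S). Qed.

Lemma indI S T x : ind (S :&: T) x = ind S x * ind T x.
Proof. by rewrite /ind inE -mulnb natrM. Qed.

Lemma ind_subset S T x : S \subset T -> ind S x <= ind T x.
Proof.
move=> /subsetP ST; rewrite /ind; case: (boolP (x \in S)) => [/ST ->|]//.
Qed.

Lemma ind_norm S x : `|ind S x| = ind S x.
Proof. by rewrite ger0_norm ?ind_ge0. Qed.

Lemma mean_ind_ge0 S : 0 <= mean (ind S).
Proof. by apply: mean_ge0 => x; apply: ind_ge0. Qed.

(* The atom at [x] of the algebra generated by [Q]; algebras are handled through
   finite sets of generators. *)
Definition cell Q x := [set y | [forall S in Q, (y \in S) == (x \in S)]].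

Lemma cellP Q x y :
  reflect (forall S, S \in Q -> (y \in S) = (x \in S)) (y \in cell Q x).
Proof.
rewrite inE; apply: (iffP forallP) => [h S SQ|h S].
  by have := h S; rewrite SQ => /eqP.
by apply/implyP => SQ; apply/eqP/h.
Qed.

Lemma cell_refl Q x : x \in cell Q x.
Proof. exact/cellP. Qed.

Lemma cell_sym Q x y : (y \in cell Q x) = (x \in cell Q y).
Proof. by apply/cellP/cellP => h S SQ; rewrite h. Qed.

Lemma cell_eq Q x y : y \in cell Q x -> cell Q y = cell Q x.
Proof.
move=> /cellP yx; apply/setP => z; apply/cellP/cellP => h S SQ.
  by rewrite h// yx.
by rewrite h// yx.
Qed.

Lemma cell_mono Q Q' x : Q \subset Q' -> cell Q' x \subset cell Q x.
Proof.
move=> /subsetP QQ; apply/subsetP => y /cellP h; apply/cellP => S SQ.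
exact/h/QQ.
Qed.

Definition cell_inv (A : Type) Q (g : X -> A) :=
  forall x y, y \in cell Q x -> g y = g x.

Lemma cell_inv_mono A Q Q' (g : X -> A) :
  Q \subset Q' -> cell_inv Q g -> cell_inv Q' g.
Proof. by move=> QQ h x y /(subsetP (cell_mono x QQ)); apply: h. Qed.

Definition cexp Q f x : R := (\sum_(y in cell Q x) f y) / #|cell Q x|%:R.

Lemma cexp_inv Q f : cell_inv Q (cexp Q f).
Proof. by move=> x y yx; rewrite /cexp (cell_eq yx). Qed.

Lemma card_cell_gt0 Q x : (0 : R) < #|cell Q x|%:R.
Proof. by rewrite ltr0n; apply/card_gt0P; exists x; apply: cell_refl. Qed.

(** Averaging over cells is self-adjoint and fixes [g]: after exchanging the sums, each [f y] is
    weighted by [g y] divided by the size of its cell, summed over that cell. *)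
Lemma mean_cexp Q f g :
  cell_inv Q g -> mean (fun x => cexp Q f x * g x) = mean (fun x => f x * g x).
Proof.
move=> gQ; rewrite /mean; congr (_ / _).
transitivity (\sum_x \sum_(y in cell Q x) f y * (g x / #|cell Q x|%:R)).
  by apply: eq_bigr => x _; rewrite -mulr_suml /cexp mulrAC mulrA.
rewrite (exchange_big_dep predT)//=; apply: eq_bigr => y _.
rewrite -mulr_sumr; congr (_ * _).
under eq_bigl => x do rewrite cell_sym.
transitivity (\sum_(i in cell Q y) (g y / #|cell Q y|%:R)).
  by apply: eq_bigr => x xy; rewrite (gQ y)// (cell_eq xy).
by rewrite sumr_const -[LHS]mulr_natr divfK// gt_eqF// card_cell_gt0.
Qed.

Lemma mean_cexp1 Q f : mean (cexp Q f) = mean f.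
Proof.
have := @mean_cexp Q f (fun=> 1) (fun _ _ _ => erefl).
by rewrite (eq_mean (fun x => mulr1 _)) => ->; apply: eq_mean => x; rewrite mulr1.
Qed.

Lemma cexp_ge0 Q f x : (forall y, 0 <= f y) -> 0 <= cexp Q f x.
Proof. by move=> f0; rewrite divr_ge0 ?ler0n ?sumr_ge0. Qed.

Lemma cexp_le1 Q f x : (forall y, f y <= 1) -> cexp Q f x <= 1.
Proof.
move=> f1; rewrite ler_pdivrMr ?card_cell_gt0// mul1r -[leRHS]sumr_const.
by apply: ler_sum => y _.
Qed.

(** Pythagoras for nested averages: the cross term equals the coarse energy, by [mean_cexp] applied
    for [Q'] and then for [Q]. *)
Lemma cexp_sqr_diff Q Q' f : Q \subset Q' ->
  mean (fun x => (cexp Q' f x - cexp Q f x) ^+ 2) =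
  mean (fun x => cexp Q' f x ^+ 2) - mean (fun x => cexp Q f x ^+ 2).
Proof.
move=> QQ; have QI := cell_inv_mono QQ (@cexp_inv Q f).
have e1 : mean (fun x => cexp Q' f x * cexp Q f x) = mean (fun x => cexp Q f x ^+ 2).
  by rewrite (mean_cexp _ QI) -(mean_cexp _ (@cexp_inv Q f)); apply: eq_mean.
rewrite (@eq_mean _ (fun x => (cexp Q' f x ^+ 2 + cexp Q f x ^+ 2)
  - 2%:R * (cexp Q' f x * cexp Q f x))); last by move=> x; ring.
by rewrite meanB meanD meanZ e1; ring.
Qed.

Lemma cexp_cell Q f x :
  mean (fun y => f y * ind (cell Q x) y) = cexp Q f x * mean (ind (cell Q x)).
Proof.
rewrite -(@mean_cexp Q); last first.
  move=> y z zy; rewrite /ind; congr (_ %:R).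
  by rewrite cell_sym (cell_eq zy) cell_sym.
rewrite -meanZ; apply: eq_mean => y; rewrite /ind.
case: (boolP (y \in cell Q x)) => [yx|]; last by rewrite !mulr0.
by rewrite (cexp_inv f yx).
Qed.

(** * Atoms and the generated algebra *)

Definition atoms Q := [set cell Q x | x : X].

(** An atom is recovered from the set of generators that contain it. *)
Lemma card_atoms Q : (#|atoms Q| <= 2 ^ #|Q|)%N.
Proof.
pose h (W : {set {set X}}) := [set y | [forall S in Q, (y \in S) == (S \in W)]].
rewrite -card_powerset; apply: leq_trans (leq_imset_card h _).
apply/subset_leq_card/subsetP => _ /imsetP[x _ ->].
apply/imsetP; exists [set S in Q | x \in S].
  by rewrite inE; apply/subsetP => S; rewrite inE => /andP[].
apply/setP => y; rewrite !inE; apply: eq_forallb => S.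
by rewrite inE; case: (S \in Q).
Qed.

(** This is the algebra generated by [Q], presented as the unions of its atoms. *)
Definition saturated Q := [set S : {set X} | [forall x in S, cell Q x \subset S]].

Lemma saturatedP Q S :
  reflect (forall x y, x \in S -> y \in cell Q x -> y \in S) (S \in saturated Q).
Proof.
rewrite inE; apply: (iffP forallP) => [h x y xS yx|h x].
  by have := h x; rewrite xS => /subsetP; apply.
by apply/implyP => xS; apply/subsetP => y; apply: h.
Qed.

(** A saturated set is the [cover] of the atoms that it contains. *)
Lemma card_saturated Q : (#|saturated Q| <= 2 ^ (2 ^ #|Q|))%N.
Proof.
apply: leq_trans (_ : 2 ^ #|atoms Q| <= _)%N; last by rewrite leq_exp2l ?card_atoms.
rewrite -card_powerset; apply: leq_trans (leq_imset_card cover _).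
apply/subset_leq_card/subsetP => S /saturatedP SQ.
apply/imsetP; exists [set A in atoms Q | A \subset S].
  by rewrite inE; apply/subsetP => A; rewrite inE => /andP[].
apply/setP => x; apply/idP/bigcupP => [xS|[A]].
  exists (cell Q x); last exact: cell_refl.
  by rewrite inE imset_f//=; apply/subsetP => y; apply: SQ.
by rewrite inE => /andP[_ /subsetP]; apply.
Qed.

Lemma is_sigma_saturated Q : is_sigma (saturated Q).
Proof.
apply/and3P; split.
- by apply/saturatedP => x y; rewrite inE.
- apply/forallP => A; apply/implyP => /saturatedP h; apply/saturatedP => x y.
  by rewrite !in_setC => + yx; apply: contra => yA; apply: (h _ _ yA); rewrite cell_sym.
apply/forallP => A; apply/implyP => /saturatedP hA.
apply/forallP => B; apply/implyP => /saturatedP hB; apply/saturatedP => x y.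
by rewrite !in_setU => /orP[xA|xB] yx; [rewrite (hA x y)|rewrite (hB x y) ?orbT].
Qed.

Hypothesis X0 : (0 < #|X|)%N.

Lemma mean_cst a : mean (fun=> a) = a.
Proof.
by rewrite /mean sumr_const -[X in X / _]mulr_natr mulfK// pnatr_eq0 -lt0n.
Qed.

Lemma mean_ind_le1 S : mean (ind S) <= 1.
Proof. by rewrite -[leRHS]mean_cst; apply: le_mean => x; apply: ind_le1. Qed.

(** The variance is nonnegative. *)
Lemma sqr_mean_le f : mean f ^+ 2 <= mean (fun x => f x ^+ 2).
Proof.
have : 0 <= mean (fun x => (f x - mean f) ^+ 2).
  by apply: mean_ge0 => x; apply: sqr_ge0.
rewrite (@eq_mean _ (fun x => (f x ^+ 2 + mean f ^+ 2) - (2%:R * mean f) * f x)).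
  by rewrite meanB meanD meanZ mean_cst; nra.
by move=> x; ring.
Qed.

End Mean.

(** * Cylinder sets and discrepancy *)

Section Cylinders.
Variables (R : realType) (n : nat) (m : 'I_n -> nat).
Local Notation J := 'I_n.
Local Notation X := (VJ m).
Implicit Types (e : {set J}) (S T : {set X}) (Q : {set {set X}}).
Implicit Types (P : {set J} -> {set {set X}}).

Definition agree e (x y : X) := forall j, j \in e -> x j = y j.

Definition cyl e S := forall x y, agree e x y -> (x \in S) = (y \in S).

Definition adapted P := forall e S, S \in P e -> cyl e S.

(** Uniformity of sets on [e] is measured relative to the facets of [e], collected in [bd]; counting
    intersects the cells of all proper subsets, collected in [lower]. *)
Definition bd P e := \bigcup_(v in e) P (e :\ v).

Definition lower P e := \bigcup_(e' : {set J} | e' \proper e) P e'.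

Lemma agree_sub e e' x y : e' \subset e -> agree e x y -> agree e' x y.
Proof. by move=> /subsetP ee h j /ee; apply: h. Qed.

Lemma cyl_sub e e' S : e' \subset e -> cyl e' S -> cyl e S.
Proof. by move=> ee h x y /(agree_sub ee); apply: h. Qed.

Lemma cylI e S T : cyl e S -> cyl e T -> cyl e (S :&: T).
Proof. by move=> hS hT x y xy; rewrite !inE (hS _ _ xy) (hT _ _ xy). Qed.

Lemma cylT e : cyl e setT.
Proof. by move=> x y _; rewrite !inE. Qed.

Lemma cyl_bigcap e (I : finType) (p : pred I) (F : I -> {set X}) :
  (forall i, p i -> cyl e (F i)) -> cyl e (\bigcap_(i | p i) F i).
Proof. by move=> h; apply: big_ind => //; [exact: cylT|exact: cylI]. Qed.

Lemma cylAlgP e S : S \in cylAlg m e <-> cyl e S.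
Proof.
split=> [/imsetP[E _ ->] x y xy|h].
  rewrite !inE; congr (_ \in E); apply/ffunP => j; rewrite !ffunE.
  exact/xy/(valP j).
apply/imsetP; exists (proj e @: S) => //; apply/setP => x; rewrite inE.
apply/idP/imsetP => [xS|[y yS exy]]; first by exists x.
rewrite (h x y)// => j je; have /ffunP/(_ (exist _ j je)) := exy.
by rewrite !ffunE.
Qed.

Lemma cyl0 S x : cyl set0 S -> x \in S -> S = setT.
Proof.
by move=> h xS; apply/setP => y; rewrite inE (h y x)// => j; rewrite inE.
Qed.

Lemma agree_cell e Q x y :
  (forall S, S \in Q -> cyl e S) -> agree e x y -> y \in cell Q x.
Proof. by move=> h xy; apply/cellP => S SQ; rewrite (h S SQ x y). Qed.

Lemma cyl_cell e Q x : (forall S, S \in Q -> cyl e S) -> cyl e (cell Q x).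
Proof.
by move=> h y z yz; rewrite cell_sym [RHS]cell_sym (cell_eq (agree_cell h yz)).
Qed.

Lemma adapted_bd P e S : adapted P -> S \in bd P e -> cyl e S.
Proof.
move=> aP /bigcupP[v ve SP]; apply: cyl_sub (aP _ _ SP); exact: subsetDl.
Qed.

Lemma adapted_lower P e S : adapted P -> S \in lower P e -> cyl e S.
Proof.
move=> aP /bigcupP[e' /andP[ee _] SP]; exact: cyl_sub (aP _ _ SP).
Qed.

Lemma bd_mono P P' e : (forall e', P e' \subset P' e') -> bd P e \subset bd P' e.
Proof.
move=> PP; apply/subsetP => S /bigcupP[v ve SP].
by apply/bigcupP; exists v => //; apply: (subsetP (PP _)).
Qed.

(** * Discrepancy against sets on all coordinates *)

Definition merge e (x y : X) : X :=
  finfun (fun j : J => if j \in e then y j else x j).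

(** Swapping the [e]-coordinates of two points is an involution of [X * X], so the hybrid of two
    independent uniform points is uniform. *)
Lemma mean_merge e (F : X -> R) : (0 < #|X|)%N ->
  mean (fun x => mean (fun y => F (merge e x y))) = mean F.
Proof.
move=> X0; rewrite /mean -mulr_suml pair_bigA/=.
transitivity ((\sum_(p : X * X) F p.1) / #|X|%:R / #|X|%:R : R).
  congr (_ / _ / _).
  have h : injective (fun p : X * X => (merge e p.1 p.2, merge e p.2 p.1)).
    apply: (can_inj (g := fun p : X * X => (merge e p.1 p.2, merge e p.2 p.1))).
    by case=> x y /=; congr pair; apply/ffunP => j; rewrite !ffunE; case: (j \in e).
  by rewrite [RHS](reindex_inj h).
rewrite -(pair_bigA _ (fun x y => F x))/=; congr (_ / _).
under eq_bigr do rewrite sumr_const.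
by rewrite sumrMnl -[X in X / _]mulr_natr mulfK// pnatr_eq0 -lt0n.
Qed.

(* Correlation with intersections of sets that each ignore a coordinate of [e]. *)
Definition disc e (f : X -> R) (eta : R) :=
  forall Tv : J -> {set X}, (forall v, v \in e -> cyl (e :\ v) (Tv v)) ->
  `|mean (fun x => f x * ind R (\bigcap_(v in e) Tv v) x)| <= eta.

(** Unlike the test sets of [disc], each [Tv v] may also depend on coordinates outside [e]; freezing
    those turns it into a test set. *)
Definition crossing e T := exists Tv : J -> {set X},
  (forall v, v \in e -> cyl [set~ v] (Tv v)) /\ T = \bigcap_(v in e) Tv v.

Lemma crossingT e : crossing e setT.
Proof.
exists (fun=> setT); split=> [v _|]; first exact: cylT.
by rewrite big1.
Qed.

Lemma crossingI e S T : crossing e S -> crossing e T -> crossing e (S :&: T).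
Proof.
move=> [Sv [hS ->]] [Tv [hT ->]]; exists (fun v => Sv v :&: Tv v); split.
  by move=> v ve; apply: cylI; [apply: hS|apply: hT].
by rewrite big_split.
Qed.

(** Some [v] in [e] is missing from [e']: take [S] as the factor at [v] and full sets elsewhere. *)
Lemma crossing_cyl e e' S : ~~ (e \subset e') -> cyl e' S -> crossing e S.
Proof.
move=> /subsetPn[v ve ve'] hS.
exists (fun w => if w == v then S else setT); split.
  move=> w we; case: eqP => [->|_]; last exact: cylT.
  apply: cyl_sub hS; apply/subsetP => j je; rewrite !inE.
  by apply: contraNneq ve' => <-.
rewrite (bigD1 v)//= eqxx big1 ?setIT// => w /andP[_ /negPf->]//.
Qed.

Lemma crossing_bigcap e (I : Type) (r : seq I) (p : pred I) (F : I -> {set X}) :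
  (forall i, p i -> crossing e (F i)) -> crossing e (\bigcap_(i <- r | p i) F i).
Proof. by move=> h; apply: big_ind => //; [exact: crossingT|exact: crossingI]. Qed.

(** By [mean_merge] the mean is an average over [x] of means in which the coordinates outside [e]
    are frozen at those of [x]; [disc] bounds each of these. *)
Lemma disc_crossing e f eta T : (0 < #|X|)%N ->
  (forall x y, agree e x y -> f x = f y) ->
  disc e f eta -> crossing e T -> `|mean (fun x => f x * ind R T x)| <= eta.
Proof.
move=> X0 fe hd [Tv [hT ->]]; rewrite -(mean_merge e)//.
apply: le_trans (ler_norm_mean _) _; rewrite -[leRHS](mean_cst X0).
apply: le_mean => x.
have /hd : forall v, v \in e -> cyl (e :\ v) [set y | merge e x y \in Tv v].
  move=> v ve y z yz; rewrite !inE; apply: hT => // j jv; rewrite !ffunE.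
  case: ifP => // je; apply: yz; move: jv; rewrite !inE je => ->//.
congr (`|_| <= _); apply: eq_mean => y; congr (_ * _).
  by apply: fe => j je; rewrite ffunE je.
rewrite /ind; congr (_ %:R); congr nat_of_bool.
by apply/bigcapP/bigcapP => h v ve; move: (h v ve); rewrite inE.
Qed.

End Cylinders.

(** * Regularity *)

Section Regularity.
Variables (R : realType) (n : nat) (m : 'I_n -> nat).
Local Notation J := 'I_n.
Local Notation X := (VJ m).
Hypothesis X0 : (0 < #|X|)%N.
Implicit Types (e : {set J}) (S T : {set X}) (Q : {set {set X}}).
Implicit Types (P : {set J} -> {set {set X}}).
Variables (F : {set J} -> {set {set X}}) (M : nat).
Hypotheses (FM : forall e, (#|F e| <= M)%N).

(** The potential of the increment argument; [F e] holds the sets to be made uniform relative to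
    [bd P e]. *)
Definition energy P : R :=
  \sum_e \sum_(A in F e) mean (fun x => cexp (bd P e) (ind R A) x ^+ 2).

Definition energy_bound : R := (2 ^ n * M)%:R.

Lemma energy_le P : energy P <= energy_bound.
Proof.
apply: (@le_trans _ _ (\sum_(e : {set J}) M%:R)); last first.
  rewrite sumr_const -[X in X <= _]mulr_natr mulrC /energy_bound natrM.
  by rewrite -cardsT -powersetT card_powerset cardsT card_ord.
apply: ler_sum => e _; apply: (@le_trans _ _ (\sum_(A in F e) 1)); last first.
  by rewrite sumr_const ler_nat.
apply: ler_sum => A _; rewrite -[leRHS](mean_cst X0); apply: le_mean => x.
by rewrite expr_le1 ?cexp_le1 ?cexp_ge0 // => y; rewrite ?ind_ge0 ?ind_le1.
Qed.

Definition dev P P' e (A : {set X}) : X -> R :=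
  fun x => cexp (bd P' e) (ind R A) x - cexp (bd P e) (ind R A) x.

(** By [cexp_sqr_diff] every summand of the energy difference is a mean square, so a single one is
    at most the total. *)
Lemma dev_energy P P' e A : (forall e, P e \subset P' e) -> A \in F e ->
  mean (fun x => dev P P' e A x ^+ 2) <= energy P' - energy P.
Proof.
move=> PP AF; rewrite /energy -sumrB.
under eq_bigr do rewrite -sumrB.
have h0 e' A' : 0 <= mean (fun x => cexp (bd P' e') (ind R A') x ^+ 2) -
    mean (fun x => cexp (bd P e') (ind R A') x ^+ 2).
  rewrite -(cexp_sqr_diff _ (bd_mono e' PP)).
  by apply: mean_ge0 => x; apply: sqr_ge0.
rewrite (bigD1 e)//= (bigD1 A)//= -(cexp_sqr_diff _ (bd_mono e PP)) -addrA lerDl.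
by rewrite addr_ge0 ?sumr_ge0// => e' _; rewrite sumr_ge0.
Qed.

Definition resid P e (A : {set X}) : X -> R :=
  fun x => ind R A x - cexp (bd P e) (ind R A) x.

(** Test sets violating [disc] are added as generators on the facets of [e]. Their intersection [T]
    is then measurable for [bd P' e], so the correlation with [T] is carried by [dev], and its
    square bounds the energy gain from below. *)
Lemma refine P k e A eta : 0 < eta -> adapted P -> (forall e, #|P e| <= k)%N ->
  A \in F e -> ~ disc e (resid P e A) eta ->
  exists P', [/\ adapted P', forall e, P e \subset P' e,
    (forall e, #|P' e| <= k + n)%N & energy P + eta ^+ 2 <= energy P'].
Proof.
move=> eta0 aP Pk AF hd.
have /boolp.existsNP[Tv /boolp.not_implyP[hT]] := hd.
set T := \bigcap_(v in e) Tv v => /negP; rewrite -ltNge => hlt.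
pose P' e' := P e' :|: [set Tv v | v in [pred v | (v \in e) && (e :\ v == e')]].
have PP' e' : P e' \subset P' e' by exact: subsetUl.
exists P'; split=> //.
- move=> e' S; rewrite inE => /orP[/aP//|/imsetP[v]].
  by rewrite inE => /andP[ve /eqP <-] ->; apply: hT.
- move=> e'; apply: leq_trans (leq_card_setU _ _) _; apply: leq_add => //.
  by apply: leq_trans (leq_imset_card _ _) _; apply: leq_trans (max_card _) _; rewrite card_ord.
rewrite addrC -lerBrDr; apply: le_trans (dev_energy PP' AF).
have invT : cell_inv (bd P' e) (ind R T).
  move=> x y /cellP yx; rewrite /ind; congr (_ %:R); congr nat_of_bool.
  have TvP v : v \in e -> Tv v \in bd P' e.
    move=> ve; apply/bigcupP; exists v => //; rewrite inE; apply/orP; right.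
    by apply: imset_f; rewrite inE ve eqxx.
  by apply/bigcapP/bigcapP => h v ve; move: (h v ve); rewrite yx// TvP.
(* The difference of the two integrands is the indicator of [A] minus its fine expectation, which is
   orthogonal to [ind R T]. *)
have e1 : mean (fun x => resid P e A x * ind R T x) =
    mean (fun x => dev P P' e A x * ind R T x).
  have : mean (fun x => cexp (bd P' e) (ind R A) x * ind R T x) -
      mean (fun x => ind R A x * ind R T x) = 0.
    by rewrite mean_cexp// subrr.
  rewrite -meanB => h; apply/eqP; rewrite -subr_eq0 -meanB -oppr_eq0 -mulN1r -meanZ.
  by rewrite -h; apply/eqP/eq_mean => x; rewrite /resid /dev; ring.
move: hlt; rewrite e1 => hlt.
apply: (@le_trans _ _ ((mean (fun x => dev P P' e A x * ind R T x)) ^+ 2)).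
  by rewrite -[leRHS]real_normK ?num_real// ler_pXn2r ?nnegrE ?normr_ge0// ltW.
apply: le_trans (sqr_mean_le X0 _) _; apply: le_mean => x.
rewrite exprMn ler_piMr ?sqr_ge0// expr_le1// ?ind_ge0// ind_le1//.
Qed.

(** Iterate [refine]; [t] bounds the number of gains of [eta ^+ 2] that still fit below the energy
    bound. *)
Lemma weak_regularity eta t k P : 0 < eta -> adapted P ->
  (forall e, #|P e| <= k)%N -> energy_bound - energy P <= t%:R * eta ^+ 2 ->
  exists P', [/\ adapted P', forall e, P e \subset P' e,
    (forall e, #|P' e| <= k + t * n)%N &
    forall e A, A \in F e -> disc e (resid P' e A) eta].
Proof.
move=> eta0; elim: t k P => [|t IH] k P aP Pk en;
  have [h|[e [A [AF hd]]]] : (forall e A, A \in F e -> disc e (resid P e A) eta) \/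
    (exists e A, A \in F e /\ ~ disc e (resid P e A) eta);
  try (by exists P; split=> // e; rewrite (leq_trans (Pk e))// leq_addr);
  try (by apply: boolp.contrapT => hn; apply: (hn); left=> e A AF;
    apply: boolp.contrapT => hd; apply: hn; right; exists e, A);
  have [P1 [aP1 PP1 P1k en1]] := refine eta0 aP Pk AF hd.
  (* For [t = 0] the energy is already maximal, so no refinement can gain. *)
  by have := energy_le P1; have := exprn_gt0 2 eta0; rewrite mul0r in en; lra.
have [|P2 [aP2 PP2 P2k h2]] := IH (k + n)%N P1 aP1 P1k.
  by rewrite -[t.+1]addn1 natrD in en; lra.
exists P2; split=> // e'; first exact: subset_trans (PP1 _) (PP2 _).
by rewrite mulSn addnA.
Qed.
End Regularity.

(* [P] is the coarse family and [P'] the fine one; the complexity of [P'] plays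
   no role. *)
Lemma strong_regularity (R : realType) (n M : nat) (eps : R) (eta : nat -> R) :
  0 < eps -> (forall k, 0 < eta k) ->
  exists K : nat, forall (m : 'I_n -> nat) (F : {set 'I_n} -> {set {set VJ m}}),
    (0 < #|VJ m|)%N -> (forall e, #|F e| <= M)%N ->
    exists k P P', [/\ (k <= K)%N, adapted P /\ adapted P',
      (forall e, #|P e| <= k)%N,
      forall e A, A \in F e -> mean (fun x => dev R P P' e A x ^+ 2) <= eps &
      forall e A, A \in F e -> disc e (resid R P' e A) (eta k)].
Proof.
move=> eps0 eta0.
(* Here [t] measures the remaining energy in units of [eps]. The tolerance [eta k] changes from
   round to round, but the bound [K] is fixed before [m] and [F]. *)
have step t k0 : exists K : nat, forall m (F : {set 'I_n} -> {set {set VJ m}}) P0,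
    (0 < #|VJ m|)%N -> (forall e, #|F e| <= M)%N -> adapted P0 ->
    (forall e, #|P0 e| <= k0)%N -> energy_bound R n M - energy R F P0 <= t%:R * eps ->
    exists k P P', [/\ (k <= K)%N, adapted P /\ adapted P',
      (forall e, #|P e| <= k)%N,
      forall e A, A \in F e -> mean (fun x => dev R P P' e A x ^+ 2) <= eps &
      forall e A, A \in F e -> disc e (resid R P' e A) (eta k)].
  have weak k : exists s : nat, forall m (F : {set 'I_n} -> {set {set VJ m}}) P,
    (0 < #|VJ m|)%N -> (forall e, #|F e| <= M)%N -> adapted P ->
    (forall e, #|P e| <= k)%N -> exists P', [/\ adapted P', forall e, P e \subset P' e,
      (forall e, #|P' e| <= k + s)%N &
      forall e A, A \in F e -> disc e (resid R P' e A) (eta k)].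
    pose s := Num.truncn (energy_bound R n M / eta k ^+ 2).
    exists (s.+1 * n)%N => m F P X0 FM aP Pk; apply: weak_regularity => //.
    have : 0 <= energy R F P.
      by do 2!apply: sumr_ge0 => ? _; apply: mean_ge0 => x; apply: sqr_ge0.
    suff : energy_bound R n M <= s.+1%:R * eta k ^+ 2 by lra.
    by rewrite -ler_pdivrMr ?exprn_gt0// ltW// truncnS_gt.
  elim: t k0 => [|t IH] k0; have [s hs] := weak k0.
    exists k0 => m F P X0 FM aP Pk en; have [P' [aP' PP' P'k hd]] := hs m F P X0 FM aP Pk.
    exists k0, P, P'; split=> // e A AF; apply: le_trans (dev_energy R PP' AF) _.
    by have := energy_le R X0 FM P'; rewrite mul0r in en; lra.
  have [K hK] := IH (k0 + s)%N; exists (maxn k0 K) => m F P X0 FM aP Pk en.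
  have [P' [aP' PP' P'k hd]] := hs m F P X0 FM aP Pk.
  (* Either the weak regularization gained little energy, and [P], [P'] are close in mean square, or
     one unit of [eps] is spent and [P'] becomes the new coarse family. *)
  have [small|big] := lerP (energy R F P' - energy R F P) eps.
    exists k0, P, P'; split=> //; first exact: leq_maxl.
    by move=> e A AF; apply: le_trans (dev_energy R PP' AF) _.
  have [|k [P1 [P2 [kK a12 h1 h2 h3]]]] := hK m F P' X0 FM aP' P'k.
    by rewrite -[t.+1]addn1 natrD in en; lra.
  by exists k, P1, P2; split=> //; rewrite leq_max kK orbT.
have [K hK] := step (Num.truncn (energy_bound R n M / eps)).+1 0%N.
exists K => m F X0 FM; apply: (hK m F (fun=> set0)) => //.
- by move=> e S; rewrite inE.
- by move=> e; rewrite cards0.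
have : 0 <= energy R F (fun=> set0).
  by do 2!apply: sumr_ge0 => ? _; apply: mean_ge0 => x; apply: sqr_ge0.
suff : energy_bound R n M <= (Num.truncn (energy_bound R n M / eps)).+1%:R * eps by lra.
by rewrite -ler_pdivrMr// ltW// truncnS_gt.
Qed.

(** * Counting *)

(** The factors are replaced by their densities one at a time, at cost [beta] each; since
    [p i <= 1], multiplying by it does not enlarge the errors already made. *)
Lemma telescope (R : realType) (X : finType) (I : eqType) (r : seq I)
    (A : I -> {set X}) (p : I -> R) (T : {set X}) (beta : R) :
  uniq r -> (forall i, 0 <= p i <= 1) ->
  (forall i s, i \in r -> {subset s <= r} -> i \notin s ->
    `|mean (fun x => ind R (T :&: \bigcap_(k <- s) A k) x * (ind R (A i) x - p i))|
      <= beta) ->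
  `|mean (ind R (T :&: \bigcap_(k <- r) A k)) - mean (ind R T) * \prod_(k <- r) p k|
    <= (size r)%:R * beta.
Proof.
move=> + p01; elim: r => [|i r IH]; first by rewrite !big_nil setIT mulr1 subrr normr0 mul0r.
move=> /= /andP[ir ur] h; rewrite !big_cons.
have {}IH : `|mean (ind R (T :&: \bigcap_(k <- r) A k)) -
    mean (ind R T) * \prod_(k <- r) p k| <= (size r)%:R * beta.
  apply: IH => // k s kr sr ks; apply: h => //; first by rewrite inE kr orbT.
  by move=> l /sr lr; rewrite inE lr orbT.
have := h i r (mem_head _ _) (fun l lr => @mem_behead _ (i :: r) l lr) ir.
set Tr := T :&: _ in IH *.
have -> : T :&: (A i :&: \bigcap_(k <- r) A k) = Tr :&: A i by rewrite [A i :&: _]setIC setIA.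
have -> : mean (fun x => ind R Tr x * (ind R (A i) x - p i)) =
    mean (ind R (Tr :&: A i)) - p i * mean (ind R Tr).
  by rewrite -meanZ -meanB; apply: eq_mean => x; rewrite indI; ring.
move: IH; set a := mean (ind R Tr); set b := mean _; set c := mean _; set q := \prod_(k <- r) _.
move=> ha hb; have /andP[p0 p1] := p01 i.
have -> : c - b * (p i * q) = (c - p i * a) + p i * (a - b * q) by ring.
apply: le_trans (ler_normD _ _) _; rewrite -natr1 mulrDl mul1r addrC; apply: lerD => //.
rewrite normrM (ger0_norm p0); apply: le_trans ha; exact: ler_piMl.
Qed.

Section Counting.
Variables (R : realType) (n : nat) (D : {set {set 'I_n}}).
Local Notation J := 'I_n.
Hypothesis Ddown : forall e e' : {set J}, e \in D -> e' \subset e -> e' \in D.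

(* The cells are read off from one point [z e] per edge, not from a single point:
   in the application the cells of the edges of [H] are the sets [E e], which
   need not share a point with the lower-order cells. *)
Definition coherent (m : J -> nat) j (P : {set J} -> {set {set VJ m}})
    (G : {set J} -> {set VJ m}) (z : {set J} -> VJ m) :=
  forall e, e \in D -> (#|e| <= j)%N ->
    z e \in G e /\ forall e' : {set J}, e' \subset e -> z e \in cell (P e') (z e').

(** Cells of edges inside [e0] may be correlated with [U], so they stay in the mean; only the other
    edges contribute a density. The error is relative to the full product. *)
Definition counts (m : J -> nat) j (P : {set J} -> {set {set VJ m}})
    (z : {set J} -> VJ m) (kappa : R) (p : {set J} -> R) :=
  forall (e0 : {set J}) (U : {set VJ m}), cyl e0 U ->
  `|mean (ind R (U :&: \bigcap_(e in D | (#|e| <= j)%N) cell (P e) (z e)))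
    - mean (ind R (U :&: \bigcap_(e in D | (#|e| <= j)%N && (e \subset e0)) cell (P e) (z e)))
      * \prod_(e in D | (#|e| <= j)%N && ~~ (e \subset e0)) p e|
    <= kappa * \prod_(e in D | (#|e| <= j)%N) p e.

(** The top level is prescribed and the lower ones are constructed. The bound [delta] comes before
    [m] because the next level must choose its discrepancy tolerance below it. *)
Definition counting_lemma j := forall (M : nat) (eps kappa : R),
  0 < eps <= 1 -> 0 < kappa <= 1 ->
  exists (K : nat) (delta : R), 0 < delta /\
  forall (m : J -> nat) (P0 : {set J} -> {set {set VJ m}}),
  (0 < #|VJ m|)%N -> adapted P0 -> (forall e, #|P0 e| <= M)%N ->
  exists (P : {set J} -> {set {set VJ m}}) (G : {set J} -> {set VJ m}),
  [/\ adapted P /\ (forall e, #|P e| <= K)%N,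
      forall e : {set J}, #|e| = j -> P e = P0 e,
      forall e x y, e \in D -> (#|e| <= j)%N ->
        (forall e' : {set J}, e' \subset e -> y \in cell (P e') x) -> x \in G e -> y \in G e,
      forall e, e \in D -> (#|e| <= j)%N -> mean (ind R (~: G e)) <= eps &
      forall z, coherent j P G z -> exists p : {set J} -> R,
        [/\ forall e, 0 <= p e <= 1, p set0 = 1,
            delta <= \prod_(e in D | (#|e| <= j)%N) p e & counts j P z kappa p]].

(** Only the empty edge occurs, and its cell is the whole space. *)
Lemma counting_base : counting_lemma 0.
Proof.
move=> M eps kappa /andP[eps0 _] /andP[kappa0 _]; exists M, 1; split=> // m P0 X0 aP PM.
exists P0, (fun=> setT); split=> //.
- by move=> e _ _; rewrite setCT /mean big1 ?mul0r ?ltW// => x _; rewrite /ind inE.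
move=> z cz; exists (fun=> 1); split=> //; rewrite ?big1//.
  by move=> e; rewrite ler01 lexx.
move=> e0 U _; rewrite [X in _ - _ * X]big1// [X in _ <= _ * X]big1// !mulr1 [X in U :&: X]big1.
  rewrite [X in _ - mean (ind R (U :&: X))]big1 ?subrr ?normr0 ?ltW//.
  move=> e /andP[_ /andP[+ _]]; rewrite leqn0 cards_eq0 => /eqP->.
  by apply: (@cyl0 _ _ _ (z set0)); [apply: cyl_cell => S /aP|apply: cell_refl].
move=> e /andP[_ ]; rewrite leqn0 cards_eq0 => /eqP->.
by apply: (@cyl0 _ _ _ (z set0)); [apply: cyl_cell => S /aP|apply: cell_refl].
Qed.

(** * One level of the counting induction *)

Section Step.
Variables (m : J -> nat) (j : nat) (P P' : {set J} -> {set {set VJ m}}).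
Variables (z : {set J} -> VJ m) (p : {set J} -> R) (delta eps' eta tau : R).
Local Notation X := (VJ m).
Hypotheses (X0 : (0 < #|X|)%N) (aP : adapted P) (aP' : adapted P').

Local Notation A e := (cell (P e) (z e)).
Local Notation L := (\bigcap_(e in D | (#|e| <= j)%N) A e).
Local Notation Lam := (\prod_(e in D | (#|e| <= j)%N) p e).

Definition bad e (B : {set X}) := [set y | eps' < `|dev R P P' e B y|].

(* The densities are bounded below, and the exceptional set is a small part of
   the intersection of all the lower-order cells. *)
Definition good_cells e := [set x |
  (tau <= cexp (bd P e) (ind R (cell (P e) x)) x) &&
  (cexp (lower P e) (ind R (bad e (cell (P e) x))) x <= eps')].

Hypothesis zcoh : forall e, e \in D -> (#|e| <= j.+1)%N ->
  forall e' : {set J}, e' \subset e -> z e \in cell (P e') (z e').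
Hypothesis zgood : forall e, e \in D -> #|e| = j.+1 -> z e \in good_cells e.
Hypothesis hdisc : forall e : {set J}, #|e| = j.+1 -> disc e (resid R P' e (A e)) eta.
Hypotheses (p01 : forall e, 0 <= p e <= 1) (p0 : p set0 = 1) (dLam : delta <= Lam).
Hypothesis hcount : counts j P z eps' p.
Hypotheses (eps0 : 0 < eps') (eps1 : eps' <= 1) (delta0 : 0 < delta).
Hypothesis (etaE : eta <= eps' * delta).

Lemma cexp_cyl e (Q : {set {set X}}) (f : X -> R) x y :
  (forall S, S \in Q -> cyl e S) -> agree e x y -> cexp Q f x = cexp Q f y.
Proof. by move=> h /(agree_cell h) xy; rewrite (cexp_inv f xy). Qed.

Lemma cyl_bad e (B : {set X}) : cyl e (bad e B).
Proof.
move=> x y xy; rewrite !inE /dev.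
rewrite (cexp_cyl _ (fun S => @adapted_bd _ _ P e S aP) xy).
by rewrite (cexp_cyl _ (fun S => @adapted_bd _ _ P' e S aP') xy).
Qed.

Lemma Lam_ge0 : 0 <= Lam.
Proof. by apply: prodr_ge0 => e _; have /andP[] := p01 e. Qed.

(** This is [counts] for [e0 = set0] and [U = setT]: the remaining mean is at most 1 and the error
    at most [Lam]. *)
Lemma mean_L_le : mean (ind R L) <= 2 * Lam.
Proof.
have := hcount (e0 := set0) (@cylT _ _ _); rewrite setTI.
rewrite [X in _ * X](_ : _ = Lam); last first.
  rewrite [RHS](bigID (fun e : {set J} => e \subset set0))/= [X in _ = X * _]big1 ?mul1r.
    by apply: eq_bigl => e; rewrite andbA.
  by move=> e /andP[_]; rewrite subset0 => /eqP->.
set a := mean (ind R (_ :&: _)) => h.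
have a1 : a <= 1 by apply: mean_ind_le1.
have := ler_norm (mean (ind R L) - a * Lam).
have := Lam_ge0; move: h; set b := mean _; set l := Lam => h l0 h1.
have : a * l <= l by apply: ler_piMl.
have : eps' * l <= l by apply: ler_piMl.
by lra.
Qed.

Section Edge.
Variable e : {set J}.
Hypotheses (eD : e \in D) (ej : #|e| = j.+1).

(** By coherence [z e] lies in each of these cells, so base points that vary with [e'] can be
    replaced by [z e]. *)
Lemma bigcap_lower :
  \bigcap_(e' in D | (#|e'| <= j)%N && (e' \subset e)) A e' = cell (lower P e) (z e).
Proof.
apply/setP => y; apply/bigcapP/cellP => [h S /bigcupP[e' ee' SP]|h e'].
  have e'e : e' \subset e by case/andP: ee'.
  have e'j : (#|e'| <= j)%N by rewrite -ltnS -ej proper_card.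
  have /cellP -> // := h e' (introT andP (conj (Ddown eD e'e) (introT andP (conj e'j e'e)))).
  by have /cellP -> // := zcoh eD (eq_leq ej) e'e.
move=> /andP[e'D /andP[e'j e'e]]; apply/cellP => S SP.
rewrite h; first by have /cellP -> // := zcoh eD (eq_leq ej) e'e.
apply/bigcupP; exists e' => //; rewrite properEcard e'e ej ltnS//.
Qed.

Lemma cexp_bd_L y : y \in L ->
  cexp (bd P e) (ind R (A e)) y = cexp (bd P e) (ind R (A e)) (z e).
Proof.
move=> /bigcapP yL; apply: cexp_inv; apply/cellP => S /bigcupP[v ve SP].
have ev : e :\ v \subset e by exact: subsetDl.
have cev : #|e :\ v| = j by have := cardsD1 v e; rewrite ve ej => -[].
have /cellP -> // := yL (e :\ v) (introT andP (conj (Ddown eD ev) (eq_leq cev))).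
by have /cellP -> // := zcoh eD (eq_leq ej) ev.
Qed.

(** Apply [counts] at [e0 = e] to the exceptional set and to [setT]. Goodness of [z e] bounds the
    former's share of the lower cell by [eps']. The main term is then at most
    [eps' * (2 + 1) * Lam], and the error adds [eps' * Lam]. *)
Lemma mean_bad_L : mean (ind R (bad e (A e) :&: L)) <= 4 * eps' * Lam.
Proof.
have := hcount (@cyl_bad e (A e)); have := hcount (@cylT _ _ e).
rewrite bigcap_lower !setTI; set Pi := \prod_(e' in D | _ && _) p e'.
have Pi0 : 0 <= Pi by apply: prodr_ge0 => e' _; have /andP[] := p01 e'.
have [_ hbad] : tau <= cexp (bd P e) (ind R (A e)) (z e) /\
    cexp (lower P e) (ind R (bad e (A e))) (z e) <= eps'.
  by have := zgood eD ej; rewrite inE => /andP[].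
rewrite (eq_mean (indI R (bad e (A e)) (cell _ _))) cexp_cell.
have := mean_L_le; have := mean_ind_ge0 R (cell (lower P e) (z e)); have := Lam_ge0.
set d := mean (ind R (cell _ _)); set l := Lam; set a := mean (ind R L); set b := mean _.
move: hbad; set q := cexp _ _ _ => hq l0 d0 al h1 h2.
have := le_trans (ler_norm _) h2; rewrite ler_norml in h1; case/andP: h1 => h1 _.
have : q * d * Pi <= eps' * (d * Pi) by rewrite -mulrA; apply: ler_wpM2r => //; exact: mulr_ge0.
have : a - d * Pi >= - (eps' * l) by lra.
have le1 : eps' * l <= l by apply: ler_piMl.
move=> h3 h4 h5; have : d * Pi <= 3 * l by lra.
move=> /(ler_wpM2l (ltW eps0)); lra.
Qed.

(** On [L] the coarse expectation is constant, so the integrand splits into [resid], controlled by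
    discrepancy because [T] is crossing, and [dev], controlled because [T] lies in [L]. *)
Lemma edge_error (T : {set X}) : crossing e T -> T \subset L ->
  `|mean (fun x => ind R T x * (ind R (A e) x - cexp (bd P e) (ind R (A e)) (z e)))|
    <= 7 * eps' * Lam.
Proof.
move=> crT TL.
rewrite (@eq_mean _ _ _ (fun x => resid R P' e (A e) x * ind R T x +
    dev R P P' e (A e) x * ind R T x)); last first.
  move=> x; have [xT|xT] := boolP (x \in T).
    by rewrite /resid /dev (cexp_bd_L (subsetP TL x xT)); ring.
  have -> : ind R T x = 0 by rewrite /ind (negPf xT).
  by ring.
(* [7 = 1 + 2 + 4]: discrepancy, [dev] off [bad], and [dev] on [bad]. *)
rewrite meanD; apply: le_trans (ler_normD _ _) _.
have h1 : `|mean (fun x => resid R P' e (A e) x * ind R T x)| <= eta.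
  apply: disc_crossing (hdisc ej) crT => // x y xy; rewrite /resid.
  rewrite (cexp_cyl _ (fun S => @adapted_bd _ _ P' e S aP') xy) /ind.
  have cA : cyl e (A e) by apply: cyl_cell => S /aP.
  by rewrite (cA _ _ xy).
have h2 : `|mean (fun x => dev R P P' e (A e) x * ind R T x)| <=
    eps' * mean (ind R L) + mean (ind R (bad e (A e) :&: L)).
  apply: le_trans (ler_norm_mean _) _; rewrite -meanZ -meanD; apply: le_mean => x.
  rewrite normrM ind_norm; apply: (@le_trans _ _ (`|dev R P P' e (A e) x| * ind R L x)).
    by apply: ler_wpM2l => //; exact: ind_subset.
  rewrite indI -mulrDl; apply: ler_wpM2r; first exact: ind_ge0.
  rewrite /ind inE; case: ltrP => [_|]; last by rewrite addr0.
  have c01 Q : 0 <= cexp Q (ind R (A e)) x <= 1.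
    by rewrite cexp_ge0 ?cexp_le1// => y; rewrite ?ind_ge0 ?ind_le1.
  have /andP[a0 a1] := c01 (bd P e); have /andP[b0 b1] := c01 (bd P' e).
  rewrite /dev ler_norml /= mulr1n; apply/andP; move: eps0; split; lra.
have h3 := mean_bad_L; have h4 := mean_L_le; move: h1 h2 h3 h4 dLam.
set a := `|_|; set b := `|_|; set d := mean _; set c := mean _; set l := Lam.
move=> h1 h2 h3 h4 h5.
have : eps' * delta <= eps' * l by apply: ler_wpM2l => //; exact: ltW.
have : eps' * d <= eps' * (2 * l) by apply: ler_wpM2l => //; exact: ltW.
by move: etaE; lra.
Qed.
End Edge.

Definition step_density (e : {set J}) :=
  if #|e| == j.+1 then cexp (bd P e) (ind R (A e)) (z e) else p e.

Lemma step_density01 e : 0 <= step_density e <= 1.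
Proof.
rewrite /step_density; case: ifP => // _.
by rewrite cexp_ge0 ?cexp_le1// => y; rewrite ?ind_ge0 ?ind_le1.
Qed.

Lemma split_level (I : Type) (idx : I) (op : Monoid.com_law idx) (q : pred {set J})
    (F : {set J} -> I) :
  \big[op/idx]_(e in D | (#|e| <= j.+1)%N && q e) F e =
  op (\big[op/idx]_(e in D | (#|e| == j.+1) && q e) F e)
     (\big[op/idx]_(e in D | (#|e| <= j)%N && q e) F e).
Proof.
rewrite (bigID (fun e : {set J} => #|e| == j.+1))/=; congr (op _ _); apply: eq_bigl => e.
  by case: eqP => [->|_]; rewrite ?leqnn ?andbT ?andbF//=.
rewrite -[(#|e| <= j)%N]ltnS [(#|e| <= j.+1)%N]leq_eqVlt.
by case: eqP => [->|_]; rewrite ?ltnn ?andbT ?andbF//=.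
Qed.

Lemma split_level0 (I : Type) (idx : I) (op : Monoid.com_law idx) (F : {set J} -> I) :
  \big[op/idx]_(e in D | (#|e| <= j.+1)%N) F e =
  op (\big[op/idx]_(e in D | #|e| == j.+1) F e)
     (\big[op/idx]_(e in D | (#|e| <= j)%N) F e).
Proof.
have := split_level op predT F.
rewrite (eq_bigl (fun e => (e \in D) && (#|e| <= j.+1)%N)) => [->|e]; last first.
  by rewrite /= andbT.
by congr (op _ _); apply: eq_bigl => e; rewrite /= andbT.
Qed.

Lemma prod_step_density (q : pred {set J}) :
  \prod_(e in D | (#|e| <= j)%N && q e) step_density e =
  \prod_(e in D | (#|e| <= j)%N && q e) p e.
Proof.
apply: eq_bigr => e /andP[_ /andP[ej _]].
by rewrite /step_density; case: eqP => // e1; rewrite e1 ltnn in ej.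
Qed.

(** Top-level cells not inside [e0] are replaced by densities through [telescope]; the lower levels
    are then handled by [hcount]. *)
Lemma counts_step kappa :
  0 < tau <= 1 -> (7 * #|{set J}|%:R + 1) * eps' <= kappa * tau ^+ #|{set J}| ->
  delta * tau ^+ #|{set J}| <= \prod_(e in D | (#|e| <= j.+1)%N) step_density e /\
  counts j.+1 P z kappa step_density.
Proof.
move=> /andP[tau0 tau1] hk.
have prodE : \prod_(e in D | (#|e| <= j.+1)%N) step_density e =
    (\prod_(e in D | #|e| == j.+1) step_density e) * Lam.
  rewrite split_level0; congr (_ * _); apply: eq_bigr => e /andP[_ ej].
  by rewrite /step_density; case: eqP => // e1; rewrite e1 ltnn in ej.
(* Goodness gives at least [tau] for each top-level edge; every other index contributes
   [1 >= tau]. *)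
have tauprod : tau ^+ #|{set J}| <= \prod_(e in D | #|e| == j.+1) step_density e.
  have -> : tau ^+ #|{set J}| = \prod_(e : {set J}) tau by rewrite prodr_const.
  rewrite [leRHS]big_mkcond; apply: ler_prod => e _; rewrite ltW//=.
  case: ifP => // /andP[eD /eqP ej]; rewrite /step_density ej eqxx.
  by have := zgood eD ej; rewrite inE => /andP[].
have Lam0 := Lam_ge0; split.
  by rewrite prodE mulrC; apply: ler_pM => //; [exact: exprn_ge0 (ltW tau0)|exact: ltW].
move=> e0 U cU; rewrite prodE !split_level prod_step_density.
set newin := \bigcap_(e in D | _ && _) A e; set oldin := \bigcap_(e in D | _ && _) A e.
set q := \prod_(e in D | _ && _) step_density e; set q' := \prod_(e in D | _ && _) p e.
(* Top-level cells inside [e0] depend only on [e0], so they can be absorbed into [U]. *)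
pose U' := U :&: newin.
have cU' : cyl e0 U'.
  apply: cylI => //; apply: cyl_bigcap => e /andP[_ /andP[_ ee]].
  by apply: cyl_sub ee _; apply: cyl_cell => S /aP.
pose r := [seq e <- index_enum {set J} | [&& e \in D, #|e| == j.+1 & ~~ (e \subset e0)]].
have -> : U :&: \bigcap_(e in D | (#|e| <= j.+1)%N) A e = (U' :&: L) :&: \bigcap_(e <- r) A e.
  rewrite split_level0 (bigID (fun e : {set J} => e \subset e0))/= /U' /newin big_filter.
  under [X in _ :&: (X :&: _ :&: _)]eq_bigl do rewrite -andbA.
  under [X in _ :&: (_ :&: X :&: _)]eq_bigl do rewrite -andbA.
  by rewrite -!setIA; congr (_ :&: (_ :&: _)); rewrite setIC.
have hq : q = \prod_(e <- r) step_density e by rewrite /q big_filter.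
have hr : (size r <= #|{set J}|)%N.
  by rewrite -(card_uniqP (filter_uniq _ (index_enum_uniq _))) max_card.
have tele : `|mean (ind R (U' :&: L :&: \bigcap_(e <- r) A e)) -
    mean (ind R (U' :&: L)) * \prod_(e <- r) step_density e| <=
    (size r)%:R * (7 * eps' * Lam).
  apply: telescope; [by rewrite filter_uniq ?index_enum_uniq|exact: step_density01|].
  move=> e s; rewrite mem_filter => /andP[/and3P[eD /eqP ej ee0] _] sr es.
  rewrite /step_density ej eqxx; apply: edge_error => //.
    (* None of the three kinds of sets sees all of [e]: [U'] lives on [e0], the lower edges are too
       small, and the other top-level edges have the same size as [e] but differ from it. *)
    apply: crossingI; first apply: crossingI.
    - exact: crossing_cyl ee0 cU'.
    - apply: crossing_bigcap => e' /andP[_ e'j].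
      apply: (@crossing_cyl _ _ e e'); last by apply: cyl_cell => S /aP.
      by apply/negP => /subset_leq_card; rewrite ej => /leq_trans/(_ e'j); rewrite ltnn.
    rewrite big_seq; apply: crossing_bigcap => e' e's.
    apply: (@crossing_cyl _ _ e e'); last by apply: cyl_cell => S /aP.
    have := sr _ e's; rewrite mem_filter => /andP[/and3P[_ /eqP e'j _] _].
    apply/negP => ee'; move: es; suff -> : e = e' by rewrite e's.
    by apply/eqP; rewrite eqEcard ee' ej e'j leqnn.
  by apply: subset_trans (subsetIl _ _) _; exact: subsetIr.
have := hcount cU'; rewrite -/q' -/oldin setIA -/U' => low.
move: tele; rewrite -hq; set a := mean _; set b := mean _ in low *.
set c := mean _ in low *; move=> tele.
have q01 : 0 <= q <= 1.
  rewrite hq prodr_ge0 ?prodr_ile1// => e _; first exact: step_density01.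
  by case/andP: (step_density01 e).
have -> : a - c * (q * q') = (a - b * q) + (b - c * q') * q by ring.
apply: le_trans (ler_normD _ _) _.
apply: (@le_trans _ _ ((7 * #|{set J}|%:R + 1) * eps' * Lam)).
  have -> : (7 * #|{set J}|%:R + 1) * eps' * Lam =
    #|{set J}|%:R * (7 * eps' * Lam) + eps' * Lam by ring.
  apply: lerD.
    apply: le_trans tele _; apply: ler_wpM2r; last by rewrite ler_nat.
    by rewrite !mulr_ge0// ltW.
  case/andP: q01 => q0 q1; rewrite normrM (ger0_norm q0).
  by apply: le_trans low; exact: ler_piMr.
rewrite mulrA; apply: ler_wpM2r => //; apply: le_trans (hk) _.
apply: ler_wpM2l => //.
have : 0 <= kappa * tau ^+ #|{set J}|.
  by apply: le_trans hk; apply: mulr_ge0; [rewrite addr_ge0// mulr_ge0// ler0n|exact: ltW].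
by rewrite pmulr_lge0// exprn_gt0.
Qed.
End Step.
End Counting.

(** * Parameters and assembly of the induction *)

Lemma pos_lower_bound (R : realType) (g : nat -> R) (K : nat) :
  (forall k, 0 < g k) -> exists d, 0 < d /\ forall k, (k <= K)%N -> d <= g k.
Proof.
move=> g0; elim: K => [|K [d [d0 hd]]].
  by exists (g 0%N); split=> // k; rewrite leqn0 => /eqP->.
exists (Num.min d (g K.+1)); split; first by rewrite lt_min d0 g0.
by move=> k; rewrite leq_eqVlt ge_min => /orP[/eqP->|/hd->//]; rewrite lexx orbT.
Qed.

(** A union bound over the atoms. Low density costs at most [tau] per atom; Chebyshev bounds [bad]
    by [eps2 / eps' ^+ 2], and Markov for its conditional expectation costs one more factor
    [eps']. *)
Lemma good_cells_measure (R : realType) n (m : 'I_n -> nat)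
    (P P' : {set 'I_n} -> {set {set VJ m}}) (eps' tau eps2 : R) (M : nat) e :
  (0 < #|VJ m|)%N -> 0 < eps' -> 0 < tau -> (#|P e| <= M)%N ->
  (forall B, B \in atoms (P e) -> mean (fun x => dev R P P' e B x ^+ 2) <= eps2) ->
  mean (ind R (~: good_cells P P' eps' tau e)) <=
    (2 ^ M)%:R * (tau + eps2 / eps' ^+ 3).
Proof.
move=> X0 eps0 tau0 PM hdev.
pose W B := [set x | cexp (bd P e) (ind R B) x < tau].
pose V B := [set x | eps' < cexp (lower P e) (ind R (bad P P' eps' e B)) x].
pose g B x := ind R B x * ind R (W B) x + ind R (V B) x.
have g0 B x : 0 <= g B x by rewrite /g addr_ge0 ?mulr_ge0 ?ind_ge0.
apply: (@le_trans _ _ (mean (fun x => \sum_(B in atoms (P e)) g B x))).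
  apply: le_mean => x; rewrite (bigD1 (cell (P e) x))/=; last exact: imset_f.
  rewrite -[leLHS]addr0; apply: lerD; last by apply: sumr_ge0.
  have [xg|] := boolP (x \in good_cells P P' eps' tau e).
    by rewrite {1}/ind inE xg /=; exact: g0.
  move=> xg; rewrite {1}/ind inE xg /=; move: xg.
  rewrite inE negb_and -!ltNge => /orP[h|h].
    have -> : g (cell (P e) x) x = 1 + ind R (V (cell (P e) x)) x.
      by rewrite /g [ind R (cell _ _) x]/ind [ind R (W _) x]/ind cell_refl inE h mulr1.
    by rewrite lerDl ind_ge0.
  have -> : g (cell (P e) x) x =
      ind R (cell (P e) x) x * ind R (W (cell (P e) x)) x + 1.
    by rewrite /g [ind R (V _) _]/ind inE h.
  by rewrite lerDr mulr_ge0 ?ind_ge0.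
rewrite mean_sum; apply: (@le_trans _ _ (\sum_(B in atoms (P e)) (tau + eps2 / eps' ^+ 3))).
  apply: ler_sum => B hB; rewrite meanD; apply: lerD.
    rewrite -(mean_cexp (Q := bd P e)); last first.
      by move=> x y yx; rewrite /ind !inE (cexp_inv _ yx).
    rewrite -[leRHS](mean_cst X0); apply: le_mean => x; rewrite /ind inE.
    by case: ltrP => [/ltW|_]; rewrite ?mulr1// mulr0 ltW.
  have h1 : mean (ind R (V B)) <= mean (ind R (bad P P' eps' e B)) / eps'.
    rewrite -(mean_cexp1 (lower P e) (ind R (bad P P' eps' e B))) mulrC -meanZ; apply: le_mean => x.
    rewrite [ind R (V B) x]/ind inE mulrC ler_pdivlMr//.
    case: ltrP => [/ltW|_]; rewrite ?mul1r// mul0r.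
    by rewrite cexp_ge0// => y; rewrite ind_ge0.
  apply: le_trans h1 _.
  have -> : eps2 / eps' ^+ 3 = eps2 / eps' ^+ 2 / eps' by field; rewrite gt_eqF.
  apply: ler_wpM2r; first by rewrite invr_ge0 ltW.
  rewrite ler_pdivlMr ?exprn_gt0//; apply: le_trans (hdev B hB).
  rewrite mulrC -meanZ; apply: le_mean => x; rewrite /ind inE.
  case: ltrP => [h|_]; last by rewrite mulr0 sqr_ge0.
  by rewrite mulr1 -[leRHS]real_normK ?num_real// ler_pXn2r ?nnegrE ?normr_ge0 ?ltW.
rewrite sumr_const -[X in X <= _]mulr_natl; apply: ler_wpM2r.
  have e20 : 0 <= eps2.
    have /card_gt0P[x _] := X0; apply: le_trans (hdev (cell (P e) x) (imset_f _ _)) => //.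
    by apply: mean_ge0 => y; apply: sqr_ge0.
  by rewrite addr_ge0 ?divr_ge0 ?exprn_ge0// ltW.
rewrite ler_nat; apply: leq_trans (card_atoms _) _.
by rewrite leq_exp2l.
Qed.

Lemma counting_step (R : realType) n (D : {set {set 'I_n}}) j :
  (forall e e' : {set 'I_n}, e \in D -> e' \subset e -> e' \in D) ->
  counting_lemma R D j -> counting_lemma R D j.+1.
Proof.
move=> Ddown IH M eps kappa /andP[eps0 eps1] /andP[kappa0 kappa1].
pose N := #|{set 'I_n}|.
have pM : (0 : R) < (2 ^ M)%:R by rewrite ltr0n expn_gt0.
have pM1 : (1 : R) <= (2 ^ M)%:R by rewrite ler1n expn_gt0.
(* With [eps2 = tau * eps' ^+ 3] below, the bound of [good_cells_measure] becomes
   [2 ^ M * (tau + tau) = eps]. *)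
pose tau := eps / 2 / (2 ^ M)%:R.
have tau0 : 0 < tau by rewrite !divr_gt0.
have tau1 : tau <= 1 by rewrite ler_pdivrMr// mul1r; lra.
have N0 : (0 : R) < 7 * N%:R + 1 by rewrite ltr_wpDl// mulr_ge0// ler0n.
(* Equality in the smallness condition of [counts_step]. *)
pose eps' := kappa * tau ^+ N / (7 * N%:R + 1).
have eps'0 : 0 < eps' by rewrite divr_gt0// mulr_gt0// exprn_gt0.
have eps'1 : eps' <= 1.
  rewrite ler_pdivrMr// mul1r; apply: (@le_trans _ _ 1).
    by rewrite mulr_ile1 ?exprn_ge0 ?exprn_ile1// ltW.
  by rewrite lerDr mulr_ge0// ler0n.
pose eps2 := tau * eps' ^+ 3.
have eps20 : 0 < eps2 by rewrite mulr_gt0// exprn_gt0.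
(* The induction hypothesis is prepared for every complexity [k]: the coarse complexity is only
   known after regularizing, and the tolerance [eps' * d0 k] must already refer to it. *)
have {}IH k := IH k eps eps' (introT andP (conj eps0 eps1)) (introT andP (conj eps'0 eps'1)).
have [K0 hK0] := boolp.choice IH.
have [d0 hd0] := boolp.choice hK0.
have dpos k : 0 < eps' * d0 k by rewrite mulr_gt0//; case: (hd0 k).
have [K1 hK1] := strong_regularity n (2 ^ M) eps20 dpos.
have [d [dpos' hd]] := @pos_lower_bound _ d0 K1 (fun k => (hd0 k).1).
exists (maxn M (\max_(k < K1.+1) K0 k)), (d * tau ^+ N); split.
  by rewrite mulr_gt0// exprn_gt0.
move=> m P0 X0 aP0 P0M.
(* The atoms of [P0 e] are regularized, since cells are what is counted. *)
have [e|k [P1 [P1' [kK [aP1 aP1'] P1k hdev hdisc]]]] :=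
    hK1 m (fun e => atoms (P0 e)) X0.
  by apply: leq_trans (card_atoms _) _; rewrite leq_exp2l.
have [P2 [G2 [[aP2 P2K] P21 loc2 mes2 cnt2]]] := (hd0 k).2 m P1 X0 aP1 P1k.
pose P (e : {set 'I_n}) := if #|e| == j.+1 then P0 e else P2 e.
pose G (e : {set 'I_n}) := if #|e| == j.+1 then good_cells P P1' eps' tau e else G2 e.
have Plow (e : {set 'I_n}) : (#|e| <= j)%N -> P e = P2 e.
  by move=> ej; rewrite /P; case: eqP => // e1; rewrite e1 ltnn in ej.
have Ptop (e : {set 'I_n}) : #|e| = j.+1 -> P e = P0 e by move=> ej; rewrite /P ej eqxx.
have Glow (e : {set 'I_n}) : (#|e| <= j)%N -> G e = G2 e.
  by move=> ej; rewrite /G; case: eqP => // e1; rewrite e1 ltnn in ej.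
have Gtop (e : {set 'I_n}) : #|e| = j.+1 -> G e = good_cells P P1' eps' tau e.
  by move=> ej; rewrite /G ej eqxx.
(* [P2] keeps the coarse family [P1] at level [j], so the regularity obtained for [P1] survives the
   refinement below. *)
have bdE (e : {set 'I_n}) : #|e| = j.+1 -> bd P e = bd P1 e.
  move=> ej; apply: eq_bigr => v ve.
  have cev : #|e :\ v| = j by have := cardsD1 v e; rewrite ve ej => -[].
  by rewrite Plow ?cev// P21.
have aP : adapted P by move=> e S; rewrite /P; case: ifP => _; [apply: aP0|apply: aP2].
have cases_card (e : {set 'I_n}) : (#|e| <= j.+1)%N -> #|e| = j.+1 \/ (#|e| <= j)%N.
  by rewrite leq_eqVlt ltnS => /orP[/eqP|]; [left|right].
exists P, G; split.
- split=> // e; rewrite leq_max /P; case: ifP => _; first by rewrite P0M.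
  apply/orP; right; apply: leq_trans (P2K e) _.
  exact: (@leq_bigmax _ (fun i : 'I_K1.+1 => K0 i) (Ordinal (kK : (k < K1.+1)%N))).
- exact: Ptop.
- move=> e x y eD /cases_card[ej|ej] hxy.
    rewrite !Gtop// !inE => /andP[h1 h2].
    have ye : y \in cell (P e) x by apply: hxy.
    have yb : y \in cell (bd P e) x.
      apply/cellP => S /bigcupP[v ve SP].
      by have /cellP -> // := hxy (e :\ v) (subsetDl _ _).
    have yl : y \in cell (lower P e) x.
      apply/cellP => S /bigcupP[e' ee' SP].
      by have /cellP -> // := hxy e' (proper_sub ee').
    by rewrite (cell_eq ye) (cexp_inv _ yb) (cexp_inv _ yl) h1.
  rewrite !Glow//; apply: loc2 => // e' ee'; rewrite -Plow; first exact: hxy.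
  exact: leq_trans (subset_leq_card ee') ej.
- move=> e eD /cases_card[ej|ej]; last by rewrite Glow//; apply: mes2.
  rewrite Gtop//; have Pe : (#|P e| <= M)%N by rewrite Ptop.
  apply: le_trans (good_cells_measure (eps2 := eps2) X0 eps'0 tau0 Pe _) _.
    move=> B; rewrite Ptop// => /hdev; congr (_ <= _); apply: eq_mean => x.
    by rewrite /dev bdE.
  rewrite /eps2 mulfK ?expf_neq0 ?gt_eqF// /tau.
  have -> : (2 ^ M)%:R * (eps / 2 / (2 ^ M)%:R + eps / 2 / (2 ^ M)%:R) =
    eps * ((2 ^ M)%:R / (2 ^ M)%:R) by field; rewrite gt_eqF.
  by rewrite divff ?mulr1// gt_eqF.
move=> z cz.
have Pz (e : {set 'I_n}) : (#|e| <= j)%N -> cell (P e) (z e) = cell (P2 e) (z e) by move=> /Plow ->.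
have [|p [p01 p0 dp cntp]] := cnt2 z.
  move=> e eD ej; have [zG zc] := cz e eD (leqW ej); rewrite -Glow//; split=> // e' ee'.
  rewrite -Plow; first exact: zc.
  exact: leq_trans (subset_leq_card ee') ej.
have cntP : counts D j P z eps' p.
  move=> e0 U cU; have := cntp e0 U cU.
  under eq_bigr => e /andP[_ ej] do rewrite -Pz//.
  by under [X in _ - mean (ind R (_ :&: X)) * _]eq_bigr => e /andP[_ /andP[ej _]] do rewrite -Pz//.
have zcoh (e : {set 'I_n}) : e \in D -> (#|e| <= j.+1)%N ->
    forall e' : {set 'I_n}, e' \subset e -> z e \in cell (P e') (z e').
  by move=> eD ej; case: (cz e eD ej).
have zgood (e : {set 'I_n}) : e \in D -> #|e| = j.+1 -> z e \in good_cells P P1' eps' tau e.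
  by move=> eD ej; have [] := cz e eD (eq_leq ej); rewrite Gtop.
have hdiscz (e : {set 'I_n}) : #|e| = j.+1 ->
    disc e (resid R P1' e (cell (P e) (z e))) (eps' * d0 k).
  by move=> ej; apply: hdisc; rewrite Ptop// imset_f.
have [|h1 h2] := counts_step Ddown X0 aP aP1' zcoh zgood hdiscz p01 p0 dp cntP eps'0 eps'1
    (hd0 k).1 (lexx _) (kappa := kappa) (introT andP (conj tau0 tau1)).
  by rewrite mulrC divfK// gt_eqF.
exists (step_density j P z p); split=> //.
- by move=> e; apply: step_density01.
- by rewrite /step_density cards0.
apply: le_trans h1; apply: ler_wpM2r; first exact: exprn_ge0 (ltW tau0).
exact: hd.
Qed.

Lemma counting (R : realType) n (D : {set {set 'I_n}}) j :
  (forall e e' : {set 'I_n}, e \in D -> e' \subset e -> e' \in D) ->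
  counting_lemma R D j.
Proof.
move=> Ddown; elim: j => [|j IH]; first exact: counting_base.
exact: counting_step.
Qed.

(** * Removal *)

Lemma expectE (R : realType) (X : finType) (g : X -> R) :
  expect [set: X] g = mean g.
Proof. by rewrite /expect /mean cardsT mulrC; under eq_bigl do rewrite inE. Qed.

Lemma is_sigmaI (T : finType) (S : {set {set T}}) A B :
  is_sigma S -> A \in S -> B \in S -> A :&: B \in S.
Proof.
move=> /and3P[_ /'forall_implyP hC /'forall_implyP hU] AS BS.
have hUS A' B' : A' \in S -> B' \in S -> A' :|: B' \in S.
  by move=> /hU/'forall_implyP; apply.
by rewrite -[A :&: B]setCK setCI; apply/hC/hUS; apply: hC.
Qed.

(** [E] is a finite union of finite intersections of cells, one for each index, and each cell
    belongs to its own algebra. *)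
Lemma saturated_bigcup_join (T : finType) (I : finType) (p : pred I)
    (Q : I -> {set {set T}}) (E : {set T}) :
  (forall x y, (forall i, p i -> y \in cell (Q i) x) -> x \in E -> y \in E) ->
  E \in sigma_join (\bigcup_(i | p i) saturated (Q i)).
Proof.
move=> hE; apply/bigcapP => S /andP[sS /subsetP FS].
have /and3P[S0 /'forall_implyP hC /'forall_implyP hU] := sS.
have ST : setT \in S by rewrite -setC0; apply: hC.
have -> : E = \bigcup_(x in E) \bigcap_(i | p i) cell (Q i) x.
  apply/setP => y; apply/idP/bigcupP => [yE|[x xE /bigcapP yx]].
    by exists y => //; apply/bigcapP => i _; apply: cell_refl.
  exact: hE xE.
apply: (big_ind (fun A => A \in S)) => // [A B AS BS|x _].
  by have /'forall_implyP := hU A AS; apply.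
apply: (big_ind (fun A => A \in S)) => // [A B|i pi]; first exact: is_sigmaI.
apply: FS; apply/bigcupP; exists i => //; apply/saturatedP => y z yx zy.
by rewrite -(cell_eq yx).
Qed.

Lemma half_count_lt (R : realFieldType) (a l delta t : R) :
  0 < delta -> 0 < t -> delta <= l -> `|a - l| <= 1 / 2 * l ->
  delta * t / 4 < a * t.
Proof.
move=> d0 t0 dl; rewrite ler_norml => /andP[h _].
by rewrite mulrAC ltr_pM2r//; lra.
Qed.

Definition removable (R : realType) (n d : nat) (H : {set {set 'I_n}})
    (m : 'I_n -> nat) (f : forall e : {set 'I_n}, Ve m e -> R) (eps : R) (K : nat) :=
  exists (E' : {set 'I_n} -> {set VJ m}) (B : {set 'I_n} -> {set {set VJ m}}),
    [/\ (forall e, e \in H -> E' e \in cylAlg m e),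
        \bigcap_(e in H) E' e = set0,
        (forall e, e \in H ->
           expect [set: VJ m]
             (fun x => f e (proj e x) * (x \notin E' e)%:R) <= eps),
        (forall e' : {set 'I_n}, (#|e'| < d)%N ->
           [/\ is_sigma (B e'), B e' \subset cylAlg m e' & (#|B e'| <= K)%N]) &
        (forall e, e \in H ->
           E' e \in sigma_join (\bigcup_(e' : {set 'I_n} | e' \proper e) B e'))].

Lemma removal (R : realType) (n d : nat) (H : {set {set 'I_n}}) (eps : R) :
  (forall e, e \in H -> #|e| = d) -> 0 < eps <= 1 ->
  exists (K : nat) (eta : R), 0 < eta /\
    forall (m : 'I_n -> nat) (f : forall e : {set 'I_n}, Ve m e -> R),
      (forall j, (0 < m j)%N) ->
      (forall e, e \in H -> forall y, 0 <= f e y <= 1) ->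
      expect [set: VJ m] (fun x => \prod_(e in H) f e (proj e x)) <= eta ->
      removable d H f eps K.
Proof.
move=> Hd /andP[eps0 eps1].
pose D := [set e' : {set 'I_n} | [exists e in H, e' \subset e]].
have Ddown (e e' : {set 'I_n}) : e \in D -> e' \subset e -> e' \in D.
  rewrite !inE => /exists_inP[e1 e1H ee1] ee; apply/exists_inP; exists e1 => //.
  exact: subset_trans ee ee1.
have HD e : e \in H -> e \in D.
  by move=> eH; rewrite inE; apply/exists_inP; exists e.
pose N := #|{set 'I_n}|.
have N1 : (1 : R) <= N%:R by rewrite ler1n; apply/card_gt0P; exists set0.
have N0 : (0 : R) < N%:R by apply: lt_le_trans N1.
pose tau := eps / 2.
have tau0 : 0 < tau by rewrite divr_gt0.
have tau1 : tau <= 1 by rewrite /tau; lra.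
(* One generator per edge of [H]; exceptional sets sum to at most [tau] over all [N] edges; relative
   error one half keeps the count positive. *)
have [||K [delta [delta0 hcount]]] := @counting R n D d Ddown 1%N (tau / N%:R) (1 / 2).
- by rewrite divr_gt0//= ler_pdivrMr// mul1r (le_trans tau1).
- by lra.
(* The count is at least [delta / 2]; the 4 makes the final contradiction strict. *)
pose eta := delta * tau ^+ #|H| / 4.
have tH0 : 0 < tau ^+ #|H| by rewrite exprn_gt0.
exists (2 ^ (2 ^ K))%N, eta; split; first by rewrite !mulr_gt0// invr_gt0.
move=> m f m0 f01; rewrite expectE => hf.
have X0 : (0 < #|VJ m|)%N.
  by apply/card_gt0P; exists (finfun (fun j => Ordinal (m0 j)) : VJ m).
pose E e := [set x : VJ m | tau <= f e (proj e x)].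
have cE e : cyl e (E e).
  move=> x y xy; rewrite !inE; congr (_ <= f e _).
  by apply/ffunP => j; rewrite !ffunE; apply: xy; exact: (valP j).
pose P0 e := if e \in H then [set E e] else set0.
have aP0 : adapted P0.
  by move=> e S; rewrite /P0; case: ifP => _; rewrite inE// => /eqP->.
have P0K e : (#|P0 e| <= 1)%N by rewrite /P0; case: ifP; rewrite ?cards1 ?cards0.
have [P [G [[aP PK] PP0 loc mes cnt]]] := hcount m P0 X0 aP0 P0K.
pose E' e := [set x | [exists y in E e, (y \in cell (lower P e) x) &&
   [forall e' : {set 'I_n}, (e' \subset e) ==> (y \in G e')]]].
have E'P e x : reflect (exists y, [/\ y \in E e, y \in cell (lower P e) x &
    forall e' : {set 'I_n}, e' \subset e -> y \in G e']) (x \in E' e).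
  rewrite inE; apply: (iffP exists_inP) => [[y yE /andP[yx /'forall_implyP yG]]|[y [yE yx yG]]];
    exists y => //; rewrite yx; exact/'forall_implyP.
have E'inv e x y : y \in cell (lower P e) x -> (x \in E' e) = (y \in E' e).
  by move=> yx; rewrite !inE (cell_eq yx).
exists E', (fun e => saturated (P e)); split.
- move=> e _; apply/cylAlgP => x y xy; apply: E'inv.
  by apply: agree_cell xy => S; apply: adapted_lower.
- apply/eqP; apply/set0Pn => -[x /bigcapP xE'].
  have /boolp.choice[ys hys] (e : {set 'I_n}) : exists y, e \in H ->
      [/\ y \in E e, y \in cell (lower P e) x &
        forall e' : {set 'I_n}, e' \subset e -> y \in G e'].
    have [eH|eH] := boolP (e \in H); last by exists x.
    by have /E'P[y hy] := xE' e eH; exists y.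
  have ys_cell (e e' : {set 'I_n}) : e \in H -> e' \proper e -> ys e \in cell (P e') x.
    move=> eH ee'; have [_ /cellP h _] := hys e eH; apply/cellP => S SP.
    by apply: h; apply/bigcupP; exists e'.
  have notH (e e' : {set 'I_n}) : e \in H -> e' \proper e -> e' \notin H.
    move=> eH /proper_card; rewrite (Hd e eH) => lt.
    by apply/negP => /Hd e'd; rewrite e'd ltnn in lt.
  (* Each edge of [H] uses its own witness, while all lower edges share [x]; the witnesses lie in
     the lower cells of [x], which gives coherence. *)
  pose z e := if e \in H then ys e else x.
  have [|p [p01 p0 dp hp]] := cnt z.
    move=> e eD ed; rewrite /z; have [eH|eH] := boolP (e \in H).
      have [_ _ yG] := hys e eH; split; first exact: yG.
      move=> e' ee'; have [->|ne] := eqVneq e' e; first by rewrite eH cell_refl.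
      have pe : e' \proper e by rewrite properEneq ne.
      by rewrite (negPf (notH _ _ eH pe)); exact: ys_cell.
    have [e1 e1H ee1] : exists2 e1, e1 \in H & e \proper e1.
      move: eD; rewrite inE => /exists_inP[e1 e1H ee1]; exists e1 => //.
      by rewrite properEneq ee1 andbT; apply: contraNneq eH => ->.
    have [_ _ yG] := hys e1 e1H; split.
      (* Goodness depends only on cells, so it passes from the witness [ys e1] to [x]. *)
      apply: loc (yG e (proper_sub ee1)) => // e' ee'.
      by rewrite cell_sym; apply: ys_cell => //; exact: sub_proper_trans ee1.
    move=> e' ee'; have pe : e' \proper e1 by exact: sub_proper_trans ee1.
    by rewrite (negPf (notH _ _ e1H pe)) cell_refl.
  have := hp set0 setT (@cylT _ _ _); rewrite !setTI.
  rewrite [X in _ - mean (ind R X) * _](_ : _ = setT); last first.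
    apply: big1 => e /andP[_ /andP[_]]; rewrite subset0 => /eqP->.
    by apply: (@cyl0 _ _ _ (z set0)); [apply: cyl_cell => S /aP|apply: cell_refl].
  have -> : mean (ind R [set: VJ m]) = 1.
    by rewrite -[RHS](mean_cst X0); apply: eq_mean => y; rewrite /ind inE.
  rewrite mul1r [X in _ - X](_ : _ = \prod_(e in D | (#|e| <= d)%N) p e); last first.
    rewrite [RHS](bigID (fun e : {set 'I_n} => e \subset set0))/= [X in _ = X * _]big1 ?mul1r.
      by apply: eq_bigl => e; rewrite andbA.
    by move=> e /andP[_]; rewrite subset0 => /eqP->.
  set a := mean _; set l := \prod_(e in D | _) _ => hal.
  (* On the intersection of the cells every [f e] with [e] in [H] is at least [tau], because that
     cell lies inside [E e]. *)
  have : a * tau ^+ #|H| <= eta.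
    apply: le_trans hf; rewrite mulrC -meanZ; apply: le_mean => y; rewrite /ind.
    have [/bigcapP yA|_] := boolP (y \in _); last first.
      by rewrite mulr0; apply: prodr_ge0 => e /f01/(_ (proj e y))/andP[].
    rewrite mulr1 -prodr_const; apply: ler_prod => e eH; rewrite (ltW tau0)/=.
    have [yE _ _] := hys e eH.
    have /cellP/(_ (E e)) := yA e (introT andP (conj (HD e eH) (eq_leq (Hd e eH)))).
    by rewrite PP0 ?Hd// /P0 eH inE /z eH yE => /(_ (eqxx _)); rewrite inE.
  by rewrite leNgt (half_count_lt delta0 tH0 dp hal).
- move=> e eH; rewrite expectE.
  (* Outside [E' e] either [f e] is below [tau] or some [G e'] fails: a point of [E e] good for all
     [e'] would witness its own membership. *)
  apply: (@le_trans _ _ (mean (fun x => tau + \sum_(e' : {set 'I_n} | e' \subset e)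
      ind R (~: G e') x))).
    apply: le_mean => x; have s0 : 0 <= \sum_(e' : {set 'I_n} | e' \subset e) ind R (~: G e') x.
      by apply: sumr_ge0 => e' _; exact: ind_ge0.
    have /andP[fx0 fx1] := f01 e eH (proj e x).
    have [xE'|xE'] := boolP (x \in E' e); first by rewrite mulr0 addr_ge0// ltW.
    rewrite mulr1; have [xE|xE] := boolP (x \in E e); last first.
      by move: xE; rewrite inE -ltNge => /ltW h; apply: le_trans h _; rewrite lerDl.
    have [/'forall_implyP xG|] := boolP [forall e' : {set 'I_n}, (e' \subset e) ==> (x \in G e')].
      by case/E'P: xE'; exists x; split=> //; exact: cell_refl.
    rewrite negb_forall => /existsP[e']; rewrite negb_imply => /andP[ee' xG].
    rewrite (bigD1 e')//= {1}/ind inE xG.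
    have : 0 <= \sum_(i : {set 'I_n} | (i \subset e) && (i != e')) ind R (~: G i) x.
      by apply: sumr_ge0 => i _; exact: ind_ge0.
    by move=> s1; apply: le_trans fx1 _; rewrite addrCA lerDl addr_ge0// ltW.
  rewrite meanD mean_cst// mean_sum.
  have : \sum_(e' : {set 'I_n} | e' \subset e) mean (ind R (~: G e')) <=
      \sum_(e' : {set 'I_n}) tau / N%:R.
    rewrite big_mkcond; apply: ler_sum => e' _; case: ifP => ee'; last first.
      by rewrite divr_ge0// ltW.
    apply: mes; first exact: Ddown (HD e eH) ee'.
    by rewrite -(Hd e eH) subset_leq_card.
  rewrite sumr_const -[X in _ <= X]mulr_natr divfK ?gt_eqF// => h.
  by rewrite [leRHS]splitr lerD2l.
- move=> e' _; split; first exact: is_sigma_saturated.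
    apply/subsetP => S /saturatedP hS; apply/cylAlgP => x y xy.
    have yx : y \in cell (P e') x by apply: agree_cell xy => T; apply: aP.
    by apply/idP/idP => h; apply: hS h _ => //; rewrite cell_sym.
  apply: leq_trans (card_saturated _) _.
  by rewrite leq_exp2l// leq_exp2l.
- move=> e _; apply: saturated_bigcup_join => x y h; rewrite (E'inv e x y)//.
  apply/cellP => S /bigcupP[e' ee' SP].
  by have /cellP -> // := h e' ee'.
Qed.

(** * From a fixed error to functions of [delta] *)

Theorem mainTheorem7 (R : realType) (n d : nat) (H : {set {set 'I_n}}) :
  (1 <= d)%N ->
  (forall e, e \in H -> #|e| = d) ->
  exists (c : R -> R) (C : R -> nat),
    (forall eps : R, 0 < eps -> exists eta : R, 0 < eta /\
        forall delta : R, 0 < delta -> delta < eta -> c delta <= eps) /\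
    forall (m : 'I_n -> nat) (f : forall e : {set 'I_n}, Ve m e -> R) (delta : R),
      (forall j, (0 < m j)%N) ->
      (forall e, e \in H -> forall y, 0 <= f e y <= 1) ->
      0 < delta -> delta < 1 ->
      expect [set: VJ m] (fun x => \prod_(e in H) f e (proj e x)) <= delta ->
      exists (E' : {set 'I_n} -> {set VJ m}) (B : {set 'I_n} -> {set {set VJ m}}),
        [/\ (forall e, e \in H -> E' e \in cylAlg m e),
            \bigcap_(e in H) E' e = set0,
            (forall e, e \in H ->
               expect [set: VJ m]
                 (fun x => f e (proj e x) * (x \notin E' e)%:R) <= c delta),
            (forall e' : {set 'I_n}, (#|e'| < d)%N ->
               [/\ is_sigma (B e'), B e' \subset cylAlg m e' & (#|B e'| <= C delta)%N]) &
            (forall e, e \in H ->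
               E' e \in sigma_join (\bigcup_(e' : {set 'I_n} | e' \proper e) B e'))].
Proof.
move=> _ Hd.
pose works (delta c : R) (C : nat) :=
  forall (m : 'I_n -> nat) (f : forall e : {set 'I_n}, Ve m e -> R),
      (forall j, (0 < m j)%N) ->
      (forall e, e \in H -> forall y, 0 <= f e y <= 1) ->
      0 < delta -> delta < 1 ->
      expect [set: VJ m] (fun x => \prod_(e in H) f e (proj e x)) <= delta ->
      removable d H f c C.
have inv01 k : 0 < (k.+1%:R^-1 : R) <= 1.
  by rewrite invr_gt0 ltr0n invf_le1 ?ltr0n// ler1n.
have [Kf hKf] := boolp.choice (fun k => removal Hd (inv01 k)).
have [etaf hetaf] := boolp.choice hKf.
(* Error 1 is always attained by empty sets; if [H] is empty the mean is 1, contradicting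
   [delta < 1]. *)
have base delta : exists C, works delta 1 C.
  exists (2 ^ (2 ^ 0))%N => m f m0 f01 delta0 delta1; rewrite expectE => hf.
  have X0 : (0 < #|VJ m|)%N.
    by apply/card_gt0P; exists (finfun (fun j => Ordinal (m0 j)) : VJ m).
  exists (fun=> set0), (fun=> saturated set0); split.
  - by move=> e _; apply/cylAlgP => x y _; rewrite !inE.
  - apply/eqP; apply/set0Pn => -[x /bigcapP xE].
    have H0 : H = set0 by apply/setP => e; rewrite inE; apply/negP => /xE; rewrite inE.
    by move: hf; rewrite H0; under eq_mean do rewrite big_set0; rewrite mean_cst// leNgt delta1.
  - move=> e eH; rewrite expectE -[leRHS](mean_cst X0); apply: le_mean => x.
    by rewrite inE mulr1; case/andP: (f01 e eH (proj e x)).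
  - move=> e' _; split; [exact: is_sigma_saturated| |].
      apply/subsetP => S /saturatedP hS; apply/cylAlgP => x y _.
      by apply/idP/idP => h; apply: hS h _; apply/cellP => T; rewrite inE.
    by apply: leq_trans (card_saturated _) _; rewrite cards0.
  - by move=> e _; apply: saturated_bigcup_join => x y _; rewrite inE.
(* Among the errors [1 / (k + 1)] with [k < t], the smallest one that [delta] allows is kept. *)
have step delta (t : nat) : exists cC : R * nat, works delta cC.1 cC.2 /\
    forall k, (k < t)%N -> delta <= etaf k -> cC.1 <= k.+1%:R^-1.
  elim: t => [|t [cC [wcC hcC]]]; first by have [C hC] := base delta; exists (1, C).
  have [le|lt] := lerP delta (etaf t).
    exists (t.+1%:R^-1, Kf t); split=> /= [m f m0 f01 _ _ hf|k kt _].
      by apply: (hetaf t).2 => //; exact: le_trans le.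
    by rewrite lef_pV2 ?posrE ?ltr0n// ler_nat.
  exists cC; split=> // k; rewrite ltnS leq_eqVlt => /orP[/eqP->|/hcC//].
  by move=> /(lt_le_trans lt); rewrite ltxx.
(* The search range grows as [delta] tends to 0, so every fixed [k] is eventually considered. *)
have [cC hcC] := boolp.choice (fun delta => step delta (Num.truncn delta^-1).+1).
exists (fun delta => (cC delta).1), (fun delta => (cC delta).2); split; last first.
  by move=> m f delta m0 f01 d0 d1 hf; apply: (hcC delta).1.
move=> eps eps0; pose k := Num.truncn eps^-1.
(* The first bound makes [k] admissible for [delta], the second puts [k] in the search range. *)
exists (Num.min (etaf k) k.+1%:R^-1); split.
  by rewrite lt_min (hetaf k).1; case/andP: (inv01 k).
move=> delta delta0; rewrite lt_min => /andP[d1 d2].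
have keps : k.+1%:R^-1 <= eps.
  by rewrite -[leRHS]invrK lef_pV2 ?posrE ?invr_gt0 ?ltr0n// ltW// truncnS_gt.
apply: le_trans keps; apply: (hcC delta).2; last exact: ltW.
rewrite ltnS truncn_ge_nat; last by rewrite invr_ge0 ltW.
apply: (@le_trans _ _ k.+1%:R); first by rewrite ler_nat.
by rewrite -[leLHS]invrK lef_pV2 ?posrE ?invr_gt0 ?ltr0n// ltW.
Qed.
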